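(* Let $L>0$ and let $(x,y)\in(0,L)^2$. For $\epsilon>0$ let $N=\lceil L/\epsilon\rceil$ and let $\mathfrak s_\epsilon(i,j)$ be the stationary spatial distribution of the Manhattan Markov Trace Model $(\mathcal T_\epsilon,\Psi_\epsilon)$ at grid point $(i\epsilon,j\epsilon)$, $i,j\in\{0,\dots,N-1\}$. Then the stationary spatial probability density satisfies $$s(x,y):=\lim_{\delta\to0^+}\ \lim_{\epsilon\to0^+}\ \frac1{4\delta^2}\sum_{i,j}\mathfrak s_\epsilon(i,j)=\frac{3}{L^3}(x+y)-\frac{3}{L^4}(x^2+y^2),$$ where the sum is over integers $i,j\in\{0,\dots,N-1\}$ with $\frac NL(x-\delta)\le i\le\frac NL(x+\delta)$ and $\frac NL(y-\delta)\le j\le\frac NL(y+\delta)$.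
   Context: Manhattan Markov Trace Model: $V_\epsilon=\{(i\epsilon,j\epsilon): i,j\in\{0,\dots,N-1\}\}$ with $N=\lceil L/\epsilon\rceil$ (assume $\epsilon$ small enough that $N\ge2$); two points are adjacent when their Euclidean distance is $\epsilon$. For distinct $v=(a,b)$ and $u=(a',b')$ in $V_\epsilon$ the feasible paths from $v$ to $u$ are: the grid path consisting of the horizontal segment from $(a,b)$ to $(a',b)$ followed by the vertical segment to $(a',b')$, and the grid path consisting of the vertical segment from $(a,b)$ to $(a,b')$ followed by the horizontal segment to $(a',b')$ (these coincide if $a=a'$ or $b=b'$). $\mathcal T_\epsilon$ is the set of point sequences $T=(T(0),\dots,T(|T|-1))$ (successive adjacent grid points, $T_{start}=T(0)$, $T_{end}=T(|T|-1)$) of all feasible paths between distinct points of $V_\epsilon$; $\Psi_\epsilon$ assigns to each $u\in V_\epsilon$ the uniform distribution $\psi_u$ over the traces of $\mathcal T_\epsilon$ starting at $u$. The model is the Markov chain on $S(\mathcal T_\epsilon)=\{\langle T,i\rangle:T\in\mathcal T_\epsilon,1\le i\le|T|-1\}$ with $\Pr(\langle T,i\rangle\to\langle T,i+1\rangle)=1$ for $1\le i<|T|-1$, $\Pr(\langle T,|T|-1\rangle\to\langle T',1\rangle)=\psi_{T_{end}}(T')$ for every $T'$ with $T'_{start}=T_{end}$, all other transition probabilities $0$. It has a unique stationary distribution $\pi$ (the uniform one). The stationary spatial distribution is $\mathfrak s_\epsilon(u)=\sum_{\langle T,i\rangle\in S(\mathcal T_\epsilon),\,T(i)=u}\pi(\langle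 T,i\rangle)$, written $\mathfrak s_\epsilon(i,j)$ for $u=(i\epsilon,j\epsilon)$. *)

(* Defs.v *)
From HB Require Import structures.
From mathcomp Require Import all_boot all_order all_algebra finmap.
From mathcomp Require Import all_classical all_reals all_analysis.

Set Implicit Arguments.
Unset Strict Implicit.
Unset Printing Implicit Defensive.

Import Order.TTheory GRing.Theory Num.Theory.
Import numFieldNormedType.Exports.

Local Open Scope ring_scope.

Section MarkovTraceModel.
Context {R : realType}.

(* A trace is the sequence of its points T(0), ..., T(|T|-1) in the plane, so
   that T(i) is [T`_i] and |T| is [size T]. *)
Definition trace : Type := seq (R * R).

Definition trace_start (T : trace) : R * R := T`_0.
Definition trace_end (T : trace) : R * R := T`_(size T).-1.

Variables (Tr : {fset seq (R * R)}) (Psi : R * R -> trace -> R).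

(* T(0) is not counted: the index of a state starts at 1. *)
Definition states : {fset seq (R * R) * nat} :=
  [fset ((T, i) : seq (R * R) * nat) |
    T : seq (R * R) in Tr, i : nat in iota 1 (size T).-1]%fset.

Definition transition (s s' : states) : R :=
  let: (T, i) := val s in
  let: (T', i') := val s' in
  if (i < (size T).-1)%N then ((T' == T) && (i' == i.+1))%:R
  else if (i' == 1)%N && (trace_start T' == trace_end T)
       then Psi (trace_end T) T' else 0.

Definition is_stationary (pi : {ffun states -> R}) : Prop :=
  [/\ forall s, 0 <= pi s,
      \sum_(s : states) pi s = 1 &
      forall s', \sum_(s : states) pi s * transition s s' = pi s'].

(* The stationary distribution when it is unique, as for irreducible chains;
   otherwise an arbitrary one, or the zero function if there is none. *)
Definition stationary_distribution : {ffun states -> R} :=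
  xget [ffun=> 0] [set pi | is_stationary pi]%classic.

Definition spatial_distribution (u : R * R) : R :=
  \sum_(s : states | (val s).1`_(val s).2 == u) stationary_distribution s.

End MarkovTraceModel.

Definition uniform_choice {R : realType} (Tr : {fset seq (R * R)})
    (u : R * R) (T : trace) : R :=
  let from_u := [fset T' in Tr | trace_start T' == u]%fset in
  if T \in from_u then (#|` from_u|%fset%:R)^-1 else 0.

Section Manhattan.
Context {R : realType}.
Variables (L e : R).

(* L / e is positive in all uses, so its ceiling is a natural number. *)
Definition grid_size : nat := `|Num.ceil (L / e)|%N.

(* Points of the grid are designated by their indices (i, j); [grid_point] is
   the corresponding point of the plane. *)
Definition grid_point (i j : nat) : R * R := (i%:R * e, j%:R * e).

(* The integers from m to n, both included, in this order, also when n < m. *)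
Definition segment (m n : nat) : seq nat :=
  if (m <= n)%N then iota m (n - m).+1 else rev (iota n (m - n).+1).

(* [behead] avoids listing the corner of the path twice. *)
Definition horizontal_vertical (v u : nat * nat) : @trace R :=
  [seq grid_point k v.2 | k <- segment v.1 u.1] ++
  [seq grid_point u.1 l | l <- behead (segment v.2 u.2)].

Definition vertical_horizontal (v u : nat * nat) : @trace R :=
  [seq grid_point v.1 l | l <- segment v.2 u.2] ++
  [seq grid_point k u.2 | k <- behead (segment v.1 u.1)].

Definition grid_indices : seq (nat * nat) :=
  [seq (i, j) | i <- iota 0 grid_size, j <- iota 0 grid_size].

Definition endpoints : seq ((nat * nat) * (nat * nat)) :=
  [seq p <- [seq (v, u) | v <- grid_indices, u <- grid_indices]
  | p.1 != p.2].

Definition manhattan_traces : {fset seq (R * R)} :=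
  ([fset horizontal_vertical p.1 p.2 | p in endpoints] `|`
   [fset vertical_horizontal p.1 p.2 | p in endpoints])%fset.

Definition manhattan_spatial (i j : nat) : R :=
  spatial_distribution manhattan_traces (uniform_choice manhattan_traces)
    (grid_point i j).

End Manhattan.

(* Main.v *)
Require Import Defs.
From mathcomp Require Import all_boot all_order all_algebra finmap.
From mathcomp Require Import all_classical all_reals all_analysis.
From mathcomp Require Import ring lra zify.

(** Since as many traces start at a grid point as end there, namely
    [2 N (N - 1)], the uniform distribution on the states is stationary; it is
    the only one, because the mass of a stationary distribution is constant
    along each trace and satisfies a maximum principle with respect to the
    starting point. Hence the spatial distribution at [(i, j)] is the proportion
    of pairs (trace, visit of [(i, j)] after the start), which a count of the
    paths evaluates to
      [3 (i (N-1-i) + j (N-1-j) + N-1) / (N^2 (N^2-1))].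
    Its sum over a box is a rational function of [1/N] and in the rounded sides of the
    box divided by [N], all of which converge as the mesh tends to [0]. The limit
    differs from the claimed density by exactly [2 delta^2 / L^4]. *)

Set Implicit Arguments.
Unset Strict Implicit.
Unset Printing Implicit Defensive.

Import Order.TTheory GRing.Theory Num.Theory.
Import numFieldNormedType.Exports.

Local Open Scope classical_set_scope.
Local Open Scope ring_scope.

(** * States as pairs of a trace and an index *)

Section States.
Context {R : realType}.

Lemma in_states (Tr : {fset seq (R * R)}) (T : @trace R) i :
  ((T, i) \in states Tr) = (T \in Tr) && (0 < i < size T)%N.
Proof.
apply/imfset2P/idP => [[T' /= hT' [i' + [-> ->]]]|].
  rewrite mem_iota => /andP[i'1 i'2]; rewrite hT' /=; lia.
case/and3P => hT i0 iT; exists T => //=; exists i => //.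
rewrite mem_iota; lia.
Qed.

Lemma sum_states (Tr : {fset seq (R * R)}) (F : @trace R * nat -> R) :
  \sum_(s : states Tr) F (val s) =
  \sum_(T <- Tr) \sum_(1 <= i < size T) F (T, i).
Proof.
rewrite -(big_seq_fsetE _ _ xpredT F) /=.
pose r := [seq (T, i) | T <- (Tr : seq _), i <- iota 1 (size T).-1].
rewrite (perm_big r) /=; last first.
  apply: uniq_perm; first exact: fset_uniq.
    apply: allpairs_uniq_dep => [||[T i] [T' i'] _ _ [-> ->]] //.
      exact: fset_uniq.
    by move=> T _; exact: iota_uniq.
  move=> [T i]; rewrite in_states; apply/idP/allpairsPdep => /=.
    case/and3P => hT i0 iT; exists T, i; split=> //.
    by rewrite mem_iota; lia.
  move=> [T' [i' [hT + [-> ->]]]]; rewrite mem_iota hT /=; lia.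
rewrite /r big_allpairs_dep; apply: eq_bigr => T _.
by rewrite /index_iota subn1.
Qed.

End States.

Lemma uniform_choiceE {R : realType} (Tr : {fset seq (R * R)}) u T :
  uniform_choice Tr u T =
  if (T \in Tr) && (trace_start T == u)
  then (count (fun T' => trace_start T' == u) Tr)%:R^-1 else 0.
Proof.
rewrite /uniform_choice !inE /=; case: ifP => // _; congr (_%:R^-1).
rewrite -size_filter; apply/perm_size/uniq_perm.
- exact: fset_uniq.
- exact/filter_uniq/fset_uniq.
- by move=> T'; rewrite !inE mem_filter andbC.
Qed.

(** * Stationary distribution of a trace model with constant in- and out-degree [D] *)

Section RegularModel.
Context {R : realType}.
Variables (Tr : {fset seq (R * R)}) (D : nat).
Hypothesis Tr_neq0 : Tr != fset0.
Hypothesis D_gt0 : (0 < D)%N.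
Hypothesis size_Tr : forall T : @trace R, T \in Tr -> (1 < size T)%N.
Hypothesis out_degree : forall T : @trace R, T \in Tr ->
  count (fun T' => trace_start T' == trace_end T) Tr = D.
Hypothesis in_degree : forall T : @trace R, T \in Tr ->
  count (fun T' => trace_end T' == trace_start T) Tr = D.
Hypothesis connected : forall T1 T2 : @trace R, T1 \in Tr -> T2 \in Tr ->
  trace_start T1 != trace_start T2 ->
  exists T, [/\ T \in Tr, trace_start T = trace_start T1
                        & trace_end T = trace_start T2].

Let Psi := uniform_choice Tr.

(** A state of index 1 is entered only from the last states of the traces ending at its start, each
    time with probability [1/D]; any other state is entered only from its predecessor on the same
    trace. *)
Lemma inflow (p : @trace R * nat -> R) (T : @trace R) i : (T, i) \in states Tr ->
  \sum_(T0 <- Tr) \sum_(1 <= j < size T0) p (T0, j) *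
    (if (j < (size T0).-1)%N then ((T == T0) && (i == j.+1))%:R
     else if (i == 1)%N && (trace_start T == trace_end T0)
       then Psi (trace_end T0) T else 0) =
  if i == 1%N
  then D%:R^-1 * \sum_(T0 <- Tr | trace_end T0 == trace_start T)
                    p (T0, (size T0).-1)
  else p (T, i.-1).
Proof.
rewrite in_states => /and3P[hT i0 iT].
have [->|i1] := eqVneq i 1%N.
  rewrite mulr_sumr [RHS]big_mkcond /= big_seq [RHS]big_seq.
  apply: eq_bigr => T0 hT0; have := size_Tr hT0.
  case: (size T0) => [//|[//|n]] _ /=.
  (* Only the last state of [T0] contributes: an inner state [j >= 1] leads to index [j + 1], which
     is not 1. *)
  rewrite big_nat_recr //= ltnn big_nat big1 => [|j /andP[j1 jn]]; last first.
    by rewrite jn eqSS (_ : (0 == j)%N = false) ?andbF ?mulr0//; lia.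
  rewrite add0r /Psi uniform_choiceE hT /= [trace_end T0 == _]eq_sym.
  case: eqP => [_|_]; last by rewrite mulr0.
  by rewrite out_degree// mulrC.
transitivity (\sum_(T0 <- Tr) \sum_(1 <= j < size T0)
   if (T == T0) && (j == i.-1) then p (T0, j) else 0).
  rewrite big_seq [RHS]big_seq; apply: eq_bigr => T0 hT0.
  rewrite big_nat [RHS]big_nat; apply: eq_bigr => j /andP[j1 js].
  rewrite (_ : (i == j.+1) = (j == i.-1)); last by lia.
  case: (eqVneq T T0) => [<-|nT] /=; last first.
    by case: ifP => _; rewrite mulr0.
  case: (eqVneq j) => [->|nj] /=; last by case: ifP => _; rewrite mulr0.
  by rewrite ifT ?mulr1//; lia.
rewrite (bigD1_seq T) ?fset_uniq //= [X in _ + X]big1 ?addr0; last first.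
  by move=> T0 nT; rewrite big1// => j _; rewrite eq_sym (negbTE nT).
rewrite (bigD1_seq i.-1) ?iota_uniq //=; last by rewrite mem_index_iota; lia.
by rewrite !eqxx big1 ?addr0// => j /negbTE ->; rewrite andbF.
Qed.

(** The stationarity equations with the inflow evaluated. Taking [p] on all pairs allows indices to
    be shifted without carrying membership proofs. *)
Definition balanced (p : @trace R * nat -> R) :=
  forall T i, (T, i) \in states Tr ->
    p (T, i) = if i == 1%N
      then D%:R^-1 * \sum_(T0 <- Tr | trace_end T0 == trace_start T)
                        p (T0, (size T0).-1)
      else p (T, i.-1).

Lemma stationaryP (p : @trace R * nat -> R) (pi : {ffun states Tr -> R}) :
    (forall s, pi s = p (val s)) ->
  (forall s', \sum_(s : states Tr) pi s * transition Psi s s' = pi s') <->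
  balanced p.
Proof.
move=> pE.
have inE (s' : states Tr) : \sum_(s : states Tr) pi s * transition Psi s s' =
    let: (T, i) := val s' in
    if i == 1%N
      then D%:R^-1 * \sum_(T0 <- Tr | trace_end T0 == trace_start T)
                        p (T0, (size T0).-1)
      else p (T, i.-1).
  case: s' => -[T i] hTi /=; rewrite -inflow//.
  rewrite -(sum_states Tr (fun s => p s *
    (if (s.2 < (size s.1).-1)%N then ((T == s.1) && (i == s.2.+1))%:R
     else if (i == 1)%N && (trace_start T == trace_end s.1)
       then Psi (trace_end s.1) T else 0))).
  by apply: eq_bigr => -[[T0 j] h] _; rewrite pE.
split=> [h T i hTi|h [[T i] hTi]].
  by have := h [` hTi]%fset; rewrite inE pE /= => ->.
by rewrite inE pE /= -h.
Qed.

Lemma stationary_start (p : @trace R * nat -> R) :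
    balanced p ->
  forall T i, (T, i) \in states Tr -> p (T, i) = p (T, 1%N).
Proof.
move=> h T; elim => [|i IH]; rewrite in_states //.
  by rewrite andbF.
case: i IH => // i IH hTi; rewrite h ?in_states//= IH// in_states; lia.
Qed.

(* The mass [q T] of a trace is an average of the masses of the traces leading
   to its start, so that the maximum of [q] spreads to all starting points. *)
Lemma stationary_const (p : @trace R * nat -> R) :
    balanced p ->
  exists c, forall T i, (T, i) \in states Tr -> p (T, i) = c.
Proof.
move=> h; have h1 := stationary_start h.
pose q T := p (T, 1%N).
have qE T : T \in Tr -> D%:R * q T =
    \sum_(T0 <- Tr | trace_end T0 == trace_start T) q T0.
  move=> hT; rewrite /q h /=; last by rewrite in_states hT size_Tr.
  rewrite mulVKf ?pnatr_eq0 -?lt0n// big_seq_cond [RHS]big_seq_cond.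
  apply: eq_bigr => T0 /andP[hT0 _]; apply: h1; rewrite in_states hT0 /=.
  by case: (size T0) (size_Tr hT0) => [|[|n]] //= _; rewrite ltnSn.
have q_start T1 T2 : T1 \in Tr -> T2 \in Tr ->
    trace_start T1 = trace_start T2 -> q T1 = q T2.
  move=> hT1 hT2 e; apply: (@mulfI _ D%:R); first by rewrite pnatr_eq0 -lt0n.
  by rewrite !qE// e.
have [M hM maxM] : exists2 M, M \in Tr & forall T, T \in Tr -> q T <= q M.
  have /fset0Pn[T0 hT0] := Tr_neq0.
  have := @arg_maxP _ _ _ [` hT0]%fset xpredT (fun T : Tr => q (val T)) isT.
  by case=> -[M hM] _ maxM; exists M => // T hT; apply: (maxM [` hT]%fset).
(* The [D] traces ending at the start of [M] have average mass [q M], so the nonnegative gaps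
   [q M - q T0] sum to zero and all vanish. *)
have pred_max T : T \in Tr -> trace_end T = trace_start M -> q T = q M.
  move=> hT eT; apply/eqP/negPn/negP => nT.
  have : \sum_(T0 <- Tr | trace_end T0 == trace_start M) (q M - q T0) = 0.
    rewrite sumrB -qE// big_const_seq iter_addr_0 in_degree// mulr_natl subrr//.
  rewrite big_seq_cond => /eqP; rewrite psumr_eq0 => [|T0 /andP[hT0 _]]; last first.
    by rewrite subr_ge0 maxM.
  move/allP => /(_ T hT); rewrite hT eT eqxx /= subr_eq0 eq_sym.
  by rewrite (negbTE nT).
exists (q M) => T i hTi; rewrite h1//; rewrite in_states in hTi.
case/andP: hTi => hT _; change (q T = q M).
have [e|ne] := eqVneq (trace_start T) (trace_start M); first exact: q_start.
(* [T'] shares its start with [T] and ends where [M] starts, so [q T = q T' = q M]. *)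
have [T' [hT' sT' eT']] := connected hT hM ne.
by rewrite -(pred_max T')//; apply: q_start.
Qed.

(** The constant function is balanced because exactly [D] traces end at each start. Conversely a
    stationary distribution is constant, and its total mass 1 fixes the constant, so [xget] can only
    pick this one. *)
Lemma stationary_distribution_regular (s : states Tr) :
  stationary_distribution Tr Psi s = #|{: states Tr}|%:R^-1.
Proof.
have card_gt0 : (0 < #|{: states Tr}|)%N.
  have /fset0Pn[T0 hT0] := Tr_neq0.
  apply/card_gt0P.
  have h : (T0, 1%N) \in states Tr by rewrite in_states hT0 size_Tr.
  by exists [` h]%fset.
pose c : R := #|{: states Tr}|%:R^-1.
have cN0 : #|{: states Tr}|%:R != 0 :> R by rewrite pnatr_eq0 -lt0n.
pose unif : {ffun states Tr -> R} := [ffun=> c].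
have unifP : is_stationary Psi unif.
  split.
  - by move=> s0; rewrite ffunE invr_ge0.
  - under eq_bigr do rewrite ffunE.
    by rewrite sumr_const -mulr_natr mulVf.
  - apply/(@stationaryP (fun=> c)) => [s0|T i]; first by rewrite ffunE.
    rewrite in_states => /andP[hT _]; case: ifP => // _.
    rewrite big_const_seq iter_addr_0 in_degree// -[_ *+ _ in X in _ * X]mulr_natl mulKf//.
    by rewrite pnatr_eq0 -lt0n.
suff uniq_pi pi : is_stationary Psi pi -> pi = unif.
  rewrite /stationary_distribution.
  by rewrite (xget_subset1 _ unifP) ?ffunE// => pi1 pi2 /uniq_pi -> /uniq_pi ->.
case=> _ sum1 bal.
(* Extension of [pi] by 0 outside the states. *)
pose p x := oapp pi 0 (insub x).
have pE s0 : pi s0 = p (val s0) by rewrite /p valK.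
have [c0 hc0] := stationary_const ((stationaryP pE).1 bal).
have piE s0 : pi s0 = c0.
  by rewrite pE; case: s0 => -[T i] h; apply: hc0.
apply/ffunP => s0; rewrite ffunE piE /c -[c0](mulfK cN0).
move: sum1; under eq_bigr do rewrite piE.
by rewrite sumr_const -(mulr_natr c0) => ->; rewrite mul1r.
Qed.

Lemma card_states : #|{: states Tr}| = (\sum_(T <- Tr) (size T).-1)%N.
Proof.
apply/eqP; rewrite -(eqr_nat R); apply/eqP.
transitivity (\sum_(s : states Tr) (1 : R)); first by rewrite sumr_const.
rewrite (sum_states Tr (fun=> 1)) natr_sum; apply: eq_bigr => T _.
by rewrite sumr_const_nat subn1.
Qed.

(** All states weigh the same, so this is a quotient of two counts; [behead] and the predecessor
    reflect that the starting point of a trace is not a state. *)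
Lemma spatial_distribution_regular u :
  spatial_distribution Tr Psi u =
  (\sum_(T <- Tr) count_mem u (behead T))%:R / (\sum_(T <- Tr) (size T).-1)%:R.
Proof.
rewrite /spatial_distribution.
rewrite (eq_bigr _ (fun s _ => stationary_distribution_regular s)).
rewrite big_mkcond /= (sum_states Tr (fun s =>
  if s.1`_s.2 == u then #|{: states Tr}|%:R^-1 else 0)) /= card_states.
set c := _^-1; rewrite natr_sum mulr_suml; apply: eq_bigr => T _.
rewrite -big_mkcond /= big_const_seq iter_addr_0 -(mulr_natl c); congr (_%:R * _).
case: T => [//|t T]; rewrite /index_iota subn1 /=.
by rewrite -[in RHS](mkseq_nth 0 T) count_map (iotaDl 1 0) count_map.
Qed.

End RegularModel.

(** * Sums over pairs and quadruples of grid indices *)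

Section IndexSums.
Local Open Scope nat_scope.
Variable N : nat.

Definition sum2 (f : nat -> nat -> nat) :=
  \sum_(0 <= a < N) \sum_(0 <= b < N) f a b.

Definition sum4 (F : nat * nat -> nat * nat -> nat) :=
  \sum_(0 <= a < N) \sum_(0 <= b < N) \sum_(0 <= c < N) \sum_(0 <= d < N)
    F (a, b) (c, d).

Lemma eq_sum2 f g : (forall a b, f a b = g a b) -> sum2 f = sum2 g.
Proof. by move=> fg; do 2 (apply: eq_bigr => ? _); exact: fg. Qed.

Lemma eq_sum4 F G : (forall v u, F v u = G v u) -> sum4 F = sum4 G.
Proof. by move=> FG; do 4 (apply: eq_bigr => ? _); exact: FG. Qed.

Lemma sum2D f g : sum2 (fun a b => f a b + g a b) = sum2 f + sum2 g.
Proof. by rewrite /sum2 -big_split; apply: eq_bigr => a _; rewrite big_split. Qed.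

Lemma sum4D F G : sum4 (fun v u => F v u + G v u) = sum4 F + sum4 G.
Proof.
rewrite /sum4 -big_split; apply: eq_bigr => a _.
rewrite -big_split; apply: eq_bigr => b _.
by rewrite -big_split; apply: eq_bigr => c _; rewrite big_split.
Qed.

Lemma sum2M f g :
  sum2 (fun a b => f a * g b) =
  (\sum_(0 <= a < N) f a) * (\sum_(0 <= b < N) g b).
Proof. by rewrite big_distrlr. Qed.

(** First and second coordinates decouple, which reduces each count over pairs of grid points to
    products of sums along one axis. *)
Lemma sum4M f g :
  sum4 (fun v u => f v.1 u.1 * g v.2 u.2) = sum2 f * sum2 g.
Proof.
rewrite /sum2 big_distrlr; do 2 (apply: eq_bigr => ? _).
by rewrite big_distrlr.
Qed.

Lemma sum_lt i : i <= N -> \sum_(0 <= a < N) (a < i) = i.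
Proof.
suff -> M : \sum_(0 <= a < M) (a < i) = minn i M by move=> iN; lia.
elim: M => [|M IH]; first by rewrite big_geq// minn0.
by rewrite big_nat_recr//= IH; case: (ltnP M i); lia.
Qed.

Lemma sum_ge i : \sum_(0 <= a < N) (i <= a) = N - i.
Proof.
elim: N => [|M IH]; first by rewrite big_geq.
by rewrite big_nat_recr//= IH; case: (leqP i M); lia.
Qed.

Lemma sum_eq i : i < N -> \sum_(0 <= a < N) (a == i) = 1.
Proof.
move=> iN; rewrite (bigD1_seq i) ?mem_index_iota ?iota_uniq//= eqxx.
by rewrite big1// => a /negbTE ->.
Qed.

Lemma sum_neq i : i < N -> \sum_(0 <= a < N) (i != a) = N.-1.
Proof.
move=> iN; have : \sum_(0 <= a < N) ((a == i) + (i != a)) = N.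
  rewrite (eq_bigr (fun=> 1)) ?sum_nat_const_nat ?muln1 ?subn0// => a _.
  by rewrite eq_sym; case: eqP.
by rewrite big_split /= sum_eq//; lia.
Qed.

Lemma sum2_eql i : i < N -> sum2 (fun a _ => a == i) = N.
Proof.
move=> iN; rewrite (eq_sum2 (g := fun a b => (a == i) * 1)) => [|a b].
  by rewrite sum2M sum_eq// sum_nat_const_nat; lia.
by rewrite muln1.
Qed.

Lemma sum2_eqr i : i < N -> sum2 (fun _ b => b == i) = N.
Proof.
by move=> iN; rewrite /sum2 exchange_big /=; apply: sum2_eql.
Qed.

Lemma sum2_eql_neq i : i < N -> sum2 (fun a b => (a == i) * (a != b)) = N.-1.
Proof.
move=> iN; rewrite (eq_sum2 (g := fun a b => (a == i) * (i != b))) => [|a b].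
  by rewrite sum2M sum_eq// sum_neq// mul1n.
by case: (eqVneq a i) => [->|].
Qed.

Lemma sum2_eqr_neq i : i < N -> sum2 (fun a b => (b == i) * (a != b)) = N.-1.
Proof.
move=> iN; rewrite -(sum2_eql_neq iN) /sum2 exchange_big /=.
by apply: eq_sum2 => a b; rewrite [a == b]eq_sym.
Qed.

Lemma sum2_eq_eq i : i < N -> sum2 (fun a b => (a == i) * (a == b)) = 1.
Proof.
move=> iN; rewrite (eq_sum2 (g := fun a b => (a == i) * (b == i))) => [|a b].
  by rewrite sum2M sum_eq.
by rewrite [b == i]eq_sym; case: (eqVneq a i) => [->|].
Qed.

Lemma sum2_neq : sum2 (fun a b => a != b) = N * N.-1.
Proof.
rewrite /sum2 big_nat (eq_bigr (fun=> N.-1)) => [|a /andP[_ aN]].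
  by rewrite -big_nat sum_nat_const_nat subn0.
exact: sum_neq.
Qed.

(* [i != a] because the starting point of a trace is not a state. *)
Definition passes (a i b : nat) := (i != a) && (minn a b <= i <= maxn a b).

(** Index [i] is passed either upwards, [a < i <= b], or downwards, [b <= i < a]; each case is a
    product of two intervals. *)
Lemma sum2_passes i : i < N ->
  sum2 (fun a b => passes a i b) = i * (N - i) + (N - i.+1) * i.+1.
Proof.
move=> iN; rewrite (eq_sum2 (g := fun a b =>
    (a < i) * (i <= b) + (i.+1 <= a) * (b < i.+1))) => [|a b].
  by rewrite sum2D !sum2M sum_lt ?sum_ge ?sum_lt// ltnW.
by rewrite /passes; case: ltngtP; case: ltnP; case: leqP; lia.
Qed.

End IndexSums.

(** The distance [|a - b|], in a form where truncated subtraction loses nothing. *)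
Definition ndist (a b : nat) : nat := (maxn a b - minn a b)%N.

Lemma ndistC a b : ndist a b = ndist b a.
Proof. by rewrite /ndist maxnC minnC. Qed.

(** By induction: the new index [N] adds one row and one column, each of sum [N (N + 1) / 2]. *)
Lemma sum2_ndist N : (3 * sum2 N ndist = N.-1 * N * N.+1)%N.
Proof.
elim: N => [|N IH]; first by rewrite /sum2 big_geq.
have sN : (2 * \sum_(0 <= a < N) ndist a N = N * N.+1)%N.
  rewrite big_nat (eq_bigr (fun a => N - a)%N) => [|a /andP[_ aN]]; last first.
    by rewrite /ndist; lia.
  rewrite -big_nat; elim: (N) => [|M IHM]; first by rewrite big_geq.
  rewrite big_nat_recl//= mulnDr; under eq_bigr do rewrite subSS.
  by rewrite IHM; lia.
have -> : sum2 N.+1 ndist =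
    (sum2 N ndist + 2 * \sum_(0 <= a < N) ndist a N)%N.
  rewrite /sum2 big_nat_recr//= [X in (_ + X)%N]big_nat_recr//=.
  under eq_bigr do rewrite big_nat_recr//=.
  rewrite big_split /= (_ : ndist N N = 0%N) ?addn0; last by rewrite /ndist; lia.
  under [X in (_ + X)%N]eq_bigr do rewrite ndistC.
  lia.
rewrite sN mulnDr IH; case: N {IH sN} => //= N; nia.
Qed.

(** * Integer segments, run through upwards or downwards *)

Section Segment.
Local Open Scope nat_scope.

Lemma segment_uniq m n : uniq (segment m n).
Proof. by rewrite /segment; case: ifP => _; rewrite ?rev_uniq iota_uniq. Qed.

Lemma mem_segment i m n : (i \in segment m n) = (minn m n <= i <= maxn m n).
Proof.
by rewrite /segment; case: ifP => mn; rewrite ?mem_rev mem_iota; lia.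
Qed.

Lemma size_segment m n : size (segment m n) = (ndist m n).+1.
Proof.
rewrite /segment /ndist; case: ifP => mn; rewrite ?size_rev size_iota; lia.
Qed.

Lemma segment_last x m n : last x (segment m n) = n.
Proof.
rewrite /segment; case: ifP => mn.
  by rewrite -addn1 iotaD last_cat /=; lia.
by rewrite [iota _ _]/= rev_cons last_rcons.
Qed.

Lemma segment_cons m n : segment m n = m :: behead (segment m n).
Proof.
rewrite /segment; case: ifP => mn //.
by rewrite -[(m - n).+1]addn1 iotaD rev_cat /= subnKC //; lia.
Qed.

Lemma segment_refl m : segment m m = [:: m].
Proof. by rewrite /segment leqnn subnn. Qed.

Lemma behead_segment_last m n : last m (behead (segment m n)) = n.
Proof. by have := segment_last m m n; rewrite segment_cons. Qed.

(** A segment has no repetition and begins with [m], so dropping its head removes exactly the index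
    [m]. *)
Lemma count_behead_segment i m n :
  count_mem i (behead (segment m n)) = passes m i n.
Proof.
have := count_uniq_mem i (segment_uniq m n).
rewrite mem_segment {1}segment_cons /= /passes.
by case: (eqVneq m i) => [->|]; rewrite ?add1n ?add0n ?eqxx //=; lia.
Qed.

End Segment.

(** * Endpoints, lengths and visits of the two feasible paths *)

Section Traces.
Context {R : realType}.
Variables (L e : R).
Hypothesis e_neq0 : e != 0.
Local Notation N := (grid_size L e).
Local Notation gp := (grid_point e).
Local Notation HV := (horizontal_vertical e).
Local Notation VH := (vertical_horizontal e).

Lemma grid_point_eq i j k l : (gp i j == gp k l) = (i == k) && (j == l).
Proof.
apply/eqP/andP => [[]|[/eqP-> /eqP->]//].
by move=> /(mulIf e_neq0)/eqP + /(mulIf e_neq0)/eqP; rewrite !eqr_nat.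
Qed.

Lemma count_grid_row s b i j :
  count_mem (gp i j) [seq gp k b | k <- s] = ((b == j) * count_mem i s)%N.
Proof.
rewrite count_map; elim: s => [|k s /= ->]; first by rewrite muln0.
by rewrite grid_point_eq andbC mulnDr mulnb.
Qed.

Lemma count_grid_column s a i j :
  count_mem (gp i j) [seq gp a l | l <- s] = ((a == i) * count_mem j s)%N.
Proof.
rewrite count_map; elim: s => [|k s /= ->]; first by rewrite muln0.
by rewrite grid_point_eq mulnDr mulnb.
Qed.

Lemma trace_endE (T : @trace R) x : T != [::] -> trace_end T = last x T.
Proof. by rewrite /trace_end; case: T => // a T _; rewrite nth_last. Qed.

Lemma HV_start v u : trace_start (HV v u) = gp v.1 v.2.
Proof. by rewrite /trace_start /horizontal_vertical segment_cons. Qed.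

Lemma VH_start v u : trace_start (VH v u) = gp v.1 v.2.
Proof. by rewrite /trace_start /vertical_horizontal segment_cons. Qed.

Lemma HV_end v u : trace_end (HV v u) = gp u.1 u.2.
Proof.
rewrite (@trace_endE _ (gp v.1 v.2)); last by rewrite /horizontal_vertical segment_cons.
rewrite last_cat (last_map (fun k => gp k v.2)) segment_last.
by rewrite (last_map (fun l => gp u.1 l)) behead_segment_last.
Qed.

Lemma VH_end v u : trace_end (VH v u) = gp u.1 u.2.
Proof.
rewrite (@trace_endE _ (gp v.1 v.2)); last by rewrite /vertical_horizontal segment_cons.
rewrite last_cat (last_map (fun k => gp v.1 k)) segment_last.
by rewrite (last_map (fun l => gp l u.2)) behead_segment_last.
Qed.

Lemma size_HV v u : size (HV v u) = (ndist v.1 u.1 + ndist v.2 u.2).+1.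
Proof. by rewrite size_cat !size_map size_behead !size_segment addSn. Qed.

Lemma size_VH v u : size (VH v u) = (ndist v.1 u.1 + ndist v.2 u.2).+1.
Proof. by rewrite size_cat !size_map size_behead !size_segment addSn addnC. Qed.

(** One term per leg. The corner is counted on the first leg only, since [passes] leaves out the
    starting index of the second. *)
Lemma count_HV v u i j :
  count_mem (gp i j) (behead (HV v u)) =
  ((v.2 == j) * passes v.1 i u.1 + (u.1 == i) * passes v.2 j u.2)%N.
Proof.
rewrite /horizontal_vertical segment_cons /= count_cat.
by rewrite count_grid_row count_grid_column !count_behead_segment.
Qed.

Lemma count_VH v u i j :
  count_mem (gp i j) (behead (VH v u)) =
  ((u.2 == j) * passes v.1 i u.1 + (v.1 == i) * passes v.2 j u.2)%N.
Proof.
rewrite /vertical_horizontal segment_cons /= count_cat addnC.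
by rewrite count_grid_row count_grid_column !count_behead_segment.
Qed.

Definition collinear (v u : nat * nat) := (v.1 == u.1) || (v.2 == u.2).

Lemma HV_collinear v u : collinear v u -> HV v u = VH v u.
Proof.
rewrite /horizontal_vertical /vertical_horizontal.
by case: v u => [a b] [c d] /orP[] /= /eqP->; rewrite segment_refl /= ?cats0
  segment_cons.
Qed.

(* The corner of the horizontal-vertical path is not on the other one. *)
Lemma HV_neq_VH v u v' u' : ~~ collinear v u -> HV v' u' != VH v u.
Proof.
move=> nc; apply/eqP => E.
have := HV_start v' u'; have := HV_end v' u'; rewrite E VH_end VH_start.
move=> /eqP + /eqP; rewrite !grid_point_eq => /andP[/eqP u1 /eqP u2].
move=> /andP[/eqP v1 /eqP v2].
have: gp u.1 v.2 \in VH v u.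
  rewrite -E mem_cat v2 u1 (map_f (fun k => gp k v'.2))//.
  by rewrite mem_segment leq_maxr geq_minr.
rewrite mem_cat => /orP[] /mapP[k _ /eqP]; rewrite grid_point_eq => /andP[].
  by move=> /eqP uv; rewrite /collinear uv eqxx in nc.
by move=> _ /eqP uv; rewrite /collinear uv eqxx orbT in nc.
Qed.

End Traces.

(** * Counting over all Manhattan traces *)

Section TraceSums.
Context {R : realType}.
Variables (L e : R).
Hypothesis e_neq0 : e != 0.
Local Notation N := (grid_size L e).
Local Notation gp := (grid_point e).
Local Notation HV := (horizontal_vertical e).
Local Notation VH := (vertical_horizontal e).

Lemma mem_endpoints v u : ((v, u) \in endpoints L e) =
  [&& v.1 < N, v.2 < N, u.1 < N, u.2 < N & v != u]%N.
Proof.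
have gridP (w : nat * nat) : (w \in grid_indices L e) = (w.1 < N)%N && (w.2 < N)%N.
  case: w => a b; apply/allpairsP/andP => /= [[[a' b'] [/= + + [-> ->]]]|[aN bN]].
    by rewrite !mem_iota.
  by exists (a, b); rewrite !mem_iota.
rewrite mem_filter andbC /= [RHS](_ : _ =
  (v \in grid_indices L e) && (u \in grid_indices L e) && (v != u)); last first.
  by rewrite !gridP -!andbA.
congr (_ && _); apply/allpairsP/andP => /= [[[a b] [/= + + [-> ->]]]|[hv hu]] //.
by exists (v, u).
Qed.

Lemma mem_traces T : reflect
  (exists v u, (v, u) \in endpoints L e /\ (T = HV v u \/ T = VH v u))
  (T \in manhattan_traces L e).
Proof.
rewrite /manhattan_traces in_fsetU; apply: (iffP orP).
  by case=> /imfsetP[[v u] /= h ->]; exists v, u; split; auto.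
by case=> v [u [h [->|->]]]; [left|right]; apply/imfsetP; exists (v, u).
Qed.

Lemma endpoints_uniq : uniq (endpoints L e).
Proof.
have ug : uniq (grid_indices L e).
  by apply: allpairs_uniq; rewrite ?iota_uniq// => -[? ?] [? ?].
by apply: filter_uniq; apply: allpairs_uniq => // -[? ?] [? ?].
Qed.

(** The union identifies the two paths of a collinear pair, so the second family is listed for the
    other pairs only. There is no further coincidence: a trace determines its endpoints, and the two
    paths of a non-collinear pair differ. *)
Lemma traces_perm : perm_eq (manhattan_traces L e)
  ([seq HV p.1 p.2 | p <- endpoints L e] ++
   [seq VH p.1 p.2 | p <- endpoints L e & ~~ collinear p.1 p.2]).
Proof.
apply: uniq_perm; first exact: fset_uniq.
  rewrite cat_uniq !map_inj_uniq ?endpoints_uniq ?(filter_uniq _ endpoints_uniq) //=.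
  - rewrite andbT; apply/hasPn => T /mapP[[v u] /=].
    rewrite mem_filter => /andP[nc _] ->; apply/mapP => -[[v' u'] _ /= E].
    by have := HV_neq_VH e_neq0 v' u' nc; rewrite E eqxx.
  - move=> [[a b] [c d]] [[a' b'] [c' d']] /= E.
    have := VH_start e (a, b) (c, d); have := VH_end e (a, b) (c, d).
    rewrite E VH_start VH_end => /eqP + /eqP; rewrite !grid_point_eq//=.
    by move=> /andP[/eqP-> /eqP->] /andP[/eqP-> /eqP->].
  - move=> [[a b] [c d]] [[a' b'] [c' d']] /= E.
    have := HV_start e (a, b) (c, d); have := HV_end e (a, b) (c, d).
    rewrite E HV_start HV_end => /eqP + /eqP; rewrite !grid_point_eq//=.
    by move=> /andP[/eqP-> /eqP->] /andP[/eqP-> /eqP->].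
move=> T; rewrite mem_cat; apply/mem_traces/orP.
  move=> [v [u [h [->|->]]]]; first by left; apply/mapP; exists (v, u).
  have [c|nc] := boolP (collinear v u).
    by left; rewrite -HV_collinear//; apply/mapP; exists (v, u).
  by right; apply/mapP; exists (v, u); rewrite // mem_filter nc.
case=> /mapP[[v u]]; first by move=> h ->; exists v, u; auto.
by rewrite mem_filter => /andP[_ h] ->; exists v, u; auto.
Qed.

Lemma sum_endpoints (F : nat * nat -> nat * nat -> nat) :
  (\sum_(p <- endpoints L e) F p.1 p.2 =
   sum4 N (fun v u => (v != u) * F v u))%N.
Proof.
rewrite /endpoints big_filter big_mkcond big_allpairs_dep /= /sum4.
rewrite /index_iota subn0 /grid_indices big_allpairs_dep.
do 2 (apply: eq_bigr => ? _); rewrite big_allpairs_dep.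
by do 2 (apply: eq_bigr => ? _); case: ifP; rewrite ?mul1n ?mul0n.
Qed.

Lemma sum_traces (F : @trace R -> nat) :
  (\sum_(T <- manhattan_traces L e) F T =
   sum4 N (fun v u => (v != u) * F (HV v u) + ~~ collinear v u * F (VH v u)))%N.
Proof.
rewrite (perm_big _ traces_perm) big_cat !big_map /=.
rewrite (sum_endpoints (fun v u => F (HV v u))) big_filter big_mkcond.
rewrite (sum_endpoints (fun v u => if ~~ collinear v u then F (VH v u) else 0%N)).
rewrite -sum4D; apply: eq_sum4 => v u; congr (_ + _)%N.
rewrite /collinear; case: v u => [a b] [c d] /=; rewrite xpair_eqE negb_or.
by case: (a == c); case: (b == d); rewrite /= ?mul1n ?mul0n.
Qed.

Lemma sum_sizes :
  (\sum_(T <- manhattan_traces L e) (size T).-1 =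
   sum2 N ndist * (2 * N * (2 * N - 1)))%N.
Proof.
(* The first two terms are the length of the horizontal-vertical path, zero when [v = u]; the last
   two are that of the other path, where a vanishing [ndist] already enforces one of the two
   inequalities of non-collinearity. *)
rewrite sum_traces (eq_sum4 _ (G := fun v u =>
   ndist v.1 u.1 * 1 + 1 * ndist v.2 u.2 +
   (ndist v.1 u.1 * (v.2 != u.2) + (v.1 != u.1) * ndist v.2 u.2))%N).
  rewrite sum4D [X in (X + _)%N]sum4D [X in (_ + X)%N]sum4D.
  rewrite (sum4M N ndist (fun _ _ => 1%N)) (sum4M N (fun _ _ => 1%N) ndist).
  rewrite (sum4M N ndist (fun a b => a != b)) (sum4M N (fun a b => a != b) ndist).
  rewrite sum2_neq {2 3}/sum2.
  rewrite !sum_nat_const_nat !subn0 muln1.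
  by case: (N) => [|M] /=; nia.
have nd a : ndist a a = 0%N by rewrite /ndist; lia.
move=> [a b] [c d]; rewrite size_HV size_VH /= xpair_eqE /collinear /=.
by case: (eqVneq a c) => [->|_]; case: (eqVneq b d) => [->|_];
  rewrite /= ?nd; lia.
Qed.

(** Each of the [N^2 - 1] targets gives a horizontal-vertical path, and the [(N - 1)^2] targets
    sharing neither coordinate give a second path. *)
Lemma start_degree i j : (i < N)%N -> (j < N)%N ->
  (count (fun T => trace_start T == gp i j) (manhattan_traces L e) =
   2 * N * N.-1)%N.
Proof.
move=> iN jN; rewrite -sum1_count big_mkcond sum_traces.
(* Horizontal-vertical paths to another first coordinate, those to the same first coordinate, then
   the vertical-horizontal paths. *)
rewrite (eq_sum4 _ (G := fun v u =>
   ((v.1 == i) * (v.1 != u.1)) * (v.2 == j) +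
   ((v.1 == i) * (v.1 == u.1)) * ((v.2 == j) * (v.2 != u.2)) +
   ((v.1 == i) * (v.1 != u.1)) * ((v.2 == j) * (v.2 != u.2)))%N).
  rewrite !sum4D.
  rewrite (sum4M N (fun a b => (a == i) * (a != b))%N (fun a _ => a == j)).
  rewrite (sum4M N (fun a b => (a == i) * (a == b))%N
                   (fun a b => (a == j) * (a != b))%N).
  rewrite (sum4M N (fun a b => (a == i) * (a != b))%N
                   (fun a b => (a == j) * (a != b))%N).
  rewrite !sum2_eql_neq// sum2_eq_eq// sum2_eql//.
  by case: (N) iN => //= M _; nia.
move=> [a b] [c d]; rewrite HV_start VH_start /= !grid_point_eq// xpair_eqE.
rewrite /collinear /=.
by case: (a == i); case: (b == j); case: (a == c); case: (b == d).
Qed.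

Lemma end_degree i j : (i < N)%N -> (j < N)%N ->
  (count (fun T => trace_end T == gp i j) (manhattan_traces L e) =
   2 * N * N.-1)%N.
Proof.
move=> iN jN; rewrite -sum1_count big_mkcond sum_traces.
rewrite (eq_sum4 _ (G := fun v u =>
   ((u.1 == i) * (v.1 != u.1)) * (u.2 == j) +
   ((u.1 == i) * (u.1 == v.1)) * ((u.2 == j) * (v.2 != u.2)) +
   ((u.1 == i) * (v.1 != u.1)) * ((u.2 == j) * (v.2 != u.2)))%N).
  rewrite !sum4D.
  rewrite (sum4M N (fun a b => (b == i) * (a != b))%N (fun _ b => b == j)).
  rewrite (sum4M N (fun a b => (b == i) * (b == a))%N
                   (fun a b => (b == j) * (a != b))%N).
  rewrite (sum4M N (fun a b => (b == i) * (a != b))%N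
                   (fun a b => (b == j) * (a != b))%N).
  rewrite !sum2_eqr_neq// sum2_eqr//.
  rewrite [sum2 _ (fun a b => (b == i) * _)%N]exchange_big /= -/(sum2 _ _).
  rewrite sum2_eq_eq//.
  by case: (N) iN => //= M _; nia.
move=> [a b] [c d]; rewrite HV_end VH_end /= !grid_point_eq// xpair_eqE.
rewrite /collinear /= [c == a]eq_sym.
by case: (c == i); case: (d == j); case: (a == c); case: (b == d).
Qed.

(** A visit on a horizontal leg fixes the height [j] of that leg and leaves the height of the other
    end free: [N] choices for horizontal-vertical paths, [N - 1] for the others, where the heights
    must differ. Vertical legs are symmetric. *)
Lemma sum_visits i j : (i < N)%N -> (j < N)%N ->
  (\sum_(T <- manhattan_traces L e) count_mem (gp i j) (behead T) =
   (2 * N - 1) * (sum2 N (fun a b => passes a i b) +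
                  sum2 N (fun a b => passes a j b)))%N.
Proof.
move=> iN jN; rewrite sum_traces.
have passes_refl a k : passes a k a = false by rewrite /passes; lia.
rewrite (eq_sum4 _ (G := fun v u =>
   passes v.1 i u.1 * (v.2 == j) + (u.1 == i) * passes v.2 j u.2 +
   (passes v.1 i u.1 * ((u.2 == j) * (v.2 != u.2)) +
    ((v.1 == i) * (v.1 != u.1)) * passes v.2 j u.2))%N).
  rewrite !sum4D.
  rewrite (sum4M N (fun a b => passes a i b) (fun a _ => a == j)).
  rewrite (sum4M N (fun _ b => b == i) (fun a b => passes a j b)).
  rewrite (sum4M N (fun a b => passes a i b) (fun a b => (b == j) * (a != b))%N).
  rewrite (sum4M N (fun a b => (a == i) * (a != b))%N (fun a b => passes a j b)).
  rewrite sum2_eql_neq// sum2_eqr_neq// sum2_eqr// sum2_eql//.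
  by case: (N) iN => //= M _; nia.
move=> [a b] [c d]; rewrite count_HV// count_VH// /= xpair_eqE /collinear /=.
case: (eqVneq a c) => [->|_]; case: (eqVneq b d) => [->|_];
  by rewrite /= ?passes_refl; lia.
Qed.

(** The factor [2 N - 1] common to visits and states cancels, and the number of passages through [i]
    simplifies to [2 i (N-1-i) + N - 1]. *)
Lemma manhattan_spatialE i j : (1 < N)%N -> (i < N)%N -> (j < N)%N ->
  manhattan_spatial L e i j =
  3 * (i%:R * (N%:R - 1 - i%:R) + j%:R * (N%:R - 1 - j%:R) + N%:R - 1)
  / (N%:R ^+ 2 * (N%:R ^+ 2 - 1)).
Proof.
move=> N1 iN jN.
have gridE T : T \in manhattan_traces L e -> exists v u,
   [/\ (v, u) \in endpoints L e, size T = (ndist v.1 u.1 + ndist v.2 u.2).+1,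
       trace_start T = gp v.1 v.2 & trace_end T = gp u.1 u.2].
  case/mem_traces => v [u [h [->|->]]]; exists v, u.
    by rewrite size_HV HV_start HV_end.
  by rewrite size_VH VH_start VH_end.
rewrite /manhattan_spatial (@spatial_distribution_regular _ _ (2 * N * N.-1)).
- rewrite sum_sizes sum_visits//.
  have := sum2_ndist N; have := sum2_passes iN; have := sum2_passes jN.
  move=> -> ->; set W := sum2 _ _ => WE.
  have {}WE : W%:R = (N%:R - 1) * N%:R * (N%:R + 1) / 3 :> R.
    apply: (@mulfI _ 3) => //; rewrite -natrM WE !natrM.
    by rewrite -subn1 natrB 1?ltnW// -addn1 natrD; field.
  rewrite !(natrM, natrD) WE !natrB//; do ?by lia.
  rewrite !natrM -(addn1 i) -(addn1 j) !natrD.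
  have : (1 : R) < N%:R by rewrite ltr1n.
  by move: (N%:R : R) => n n1; field; rewrite !gt_eqF//; nra.
- apply/fset0Pn; exists (HV (0, 0)%N (1, 1)%N); apply/mem_traces.
  exists (0, 0)%N, (1, 1)%N; split; last by left.
  by rewrite mem_endpoints /= N1 ltnW.
- by rewrite !muln_gt0 /=; lia.
- move=> T /gridE[v [u [+ -> _ _]]]; rewrite mem_endpoints.
  case: v u => [a b] [c d]; rewrite /ndist xpair_eqE /=; lia.
- move=> T /gridE[v [u [+ _ _ ->]]]; rewrite mem_endpoints.
  by case/and5P => _ _ u1 u2 _; exact: start_degree.
- move=> T /gridE[v [u [+ _ -> _]]]; rewrite mem_endpoints.
  by case/and5P => v1 v2 _ _ _; exact: end_degree.
- move=> T1 T2 /gridE[v1 [u1 [h1 _ -> _]]] /gridE[v2 [u2 [h2 _ -> _]]] ne.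
  (* Any two distinct grid points are joined by a single trace. *)
  exists (HV v1 v2); rewrite HV_start HV_end; split => //.
  apply/mem_traces; exists v1, v2; split; last by left.
  move: h1 h2; rewrite !mem_endpoints => /and5P[-> -> _ _ _] /and5P[-> -> _ _ _].
  by apply: contraNneq ne => ->.
Qed.

End TraceSums.

(** * Exact sum of the spatial distribution over a box *)

Section BoxSum.
Context {R : realType}.

(* Meaningful for [0 <= z] only. *)
Definition ceiln (z : R) : nat := `|Num.ceil z|%N.

Lemma ceiln_le_nat (z : R) i : 0 <= z -> (ceiln z <= i)%N = (z <= i%:R).
Proof.
move=> z0; have c0 : 0 <= Num.ceil z by rewrite -(ceil0 R) ceil_le.
by rewrite -[i%:R]/((Posz i)%:~R) -ceil_le_int /ceiln -lez_nat gez0_abs.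
Qed.

Lemma ceiln_bounds (z : R) : 0 <= z -> z <= (ceiln z)%:R <= z + 1.
Proof.
move=> z0; rewrite -ceiln_le_nat// leqnn /=.
case E : (ceiln z) => [|k]; first by rewrite ler_wpDl.
have : ~~ (ceiln z <= k)%N by rewrite E ltnn.
by rewrite ceiln_le_nat// -ltNge -natr1 lerD2r => /ltW.
Qed.

(** For [0 <= z], the exclusive upper end of the range of indices [i <= z]. *)
Definition truncS (z : R) : nat := (Num.truncn z).+1.

Lemma truncS_bounds (z : R) : 0 <= z -> z <= (truncS z)%:R <= z + 1.
Proof.
move=> z0; rewrite ltW ?truncnS_gt//= /truncS -natr1 lerD2r.
by rewrite truncn_le.
Qed.

(** Since [q < 1], every index up to [N q] is below [N], so the grid does not cut the range. *)
Lemma sum_itv (N : nat) (p q : R) (F : nat -> R) : 0 <= p -> p <= q -> q < 1 ->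
    (0 < N)%N ->
  \sum_(i < N | N%:R * p <= i%:R <= N%:R * q) F i =
  \sum_(ceiln (N%:R * p) <= i < truncS (N%:R * q)) F i.
Proof.
move=> p0 pq q1 N0.
have Np0 : 0 <= N%:R * p by rewrite mulr_ge0.
have Nq0 : 0 <= N%:R * q by rewrite mulr_ge0// (le_trans p0).
rewrite -(big_mkord (fun i => N%:R * p <= i%:R <= N%:R * q) F).
rewrite [RHS](big_nat_widenl _ 0%N)// [RHS](big_nat_widen _ _ N); last first.
  by rewrite /truncS truncn_lt_nat// -[ltRHS]mulr1 ltr_pM2l// ltr0n.
apply: eq_bigl => i; rewrite /= ceiln_le_nat// /truncS ltnS.
by rewrite truncn_ge_nat.
Qed.

(* With [r = 1/N] and [t = k/N], this is [N^-3] times the sum of [i (N-1-i)]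
   over [i < k]. *)
Definition cubic (r t : R) : R :=
  (1 - r) * t * (t - r) / 2 - t * (t - r) * (2 * t - r) / 6.

(** The summand is a consecutive difference of [N^3] times [cubic], so the sum telescopes. *)
Lemma sum_parabola (N m n : nat) : (0 < N)%N -> (m <= n)%N ->
  \sum_(m <= i < n) i%:R * (N%:R - 1 - i%:R) =
  N%:R ^+ 3 * (cubic N%:R^-1 (n%:R / N%:R) - cubic N%:R^-1 (m%:R / N%:R)) :> R.
Proof.
move=> N0 mn; rewrite mulrBr.
have NN0 : N%:R != 0 :> R by rewrite pnatr_eq0 -lt0n.
rewrite -(telescope_sumr (fun k : nat => N%:R ^+ 3 * cubic N%:R^-1 (k%:R / N%:R)) mn).
apply: eq_bigr => i _; rewrite /cubic -natr1.
by field.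
Qed.

Lemma sumr_const_natr (x : R) (m n : nat) : (m <= n)%N ->
  \sum_(m <= i < n) x = x * (n%:R - m%:R).
Proof. by move=> mn; rewrite sumr_const_nat -natrB// mulr_natr. Qed.

(** The exact box sum at [r = 1/N], with the sides divided by [N]; it extends continuously to
    [r = 0], where the last term, coming from the summand [N - 1], vanishes. *)
Definition box_limit (r a1 b1 a2 b2 : R) : R :=
  3 / (1 - r ^+ 2) * ((cubic r b1 - cubic r a1) * (b2 - a2) +
    (b1 - a1) * (cubic r b2 - cubic r a2) +
    r * (1 - r) * (b1 - a1) * (b2 - a2)).

Lemma box_sum (L e p1 q1 p2 q2 : R) (N := grid_size L e)
    (m1 := ceiln (N%:R * p1)) (n1 := truncS (N%:R * q1))
    (m2 := ceiln (N%:R * p2)) (n2 := truncS (N%:R * q2)) :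
    e != 0 -> (1 < N)%N ->
    0 <= p1 -> p1 <= q1 -> q1 < 1 -> 0 <= p2 -> p2 <= q2 -> q2 < 1 ->
  \sum_(i < N | N%:R * p1 <= i%:R <= N%:R * q1)
    \sum_(j < N | N%:R * p2 <= j%:R <= N%:R * q2) manhattan_spatial L e i j =
  box_limit N%:R^-1 (m1%:R / N%:R) (n1%:R / N%:R) (m2%:R / N%:R) (n2%:R / N%:R).
Proof.
move=> e0 N1 p10 pq1 q11 p20 pq2 q21.
have N0 : (0 < N)%N by exact: ltnW.
have mn p q : 0 <= p -> p <= q -> (ceiln (N%:R * p) <= truncS (N%:R * q))%N.
  move=> p0 pq; rewrite ceiln_le_nat ?mulr_ge0//.
  apply: (le_trans (ler_wpM2l _ pq)) => //; apply/ltW/truncnS_gt.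
have N1' : 1 < N%:R :> R by rewrite ltr1n.
(* Up to a factor, a function of [i] plus a function of [j] plus a constant, so the double sum
   splits into sums over one index. *)
pose f (i j : nat) : R := 3 / (N%:R ^+ 2 * (N%:R ^+ 2 - 1)) *
  (i%:R * (N%:R - 1 - i%:R) + (j%:R * (N%:R - 1 - j%:R) + (N%:R - 1))).
have K i j : (i < N)%N -> (j < N)%N -> manhattan_spatial L e i j = f i j.
  by move=> iN jN; rewrite manhattan_spatialE// mulrAC; congr (_ * _); ring.
transitivity (\sum_(i < N | N%:R * p1 <= i%:R <= N%:R * q1)
    \sum_(j < N | N%:R * p2 <= j%:R <= N%:R * q2) f i j).
  by apply: eq_bigr => i _; apply: eq_bigr => j _; rewrite K.
rewrite (sum_itv
  (fun i => \sum_(j < N | N%:R * p2 <= j%:R <= N%:R * q2) f i j))//.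
under eq_bigr => i _.
  rewrite (sum_itv (f i))// -mulr_sumr !big_split /= !sumr_const_natr ?mn//.
  rewrite sum_parabola ?mn//.
  over.
rewrite -mulr_sumr !big_split /= !sumr_const_natr ?mn// -mulr_suml sum_parabola ?mn//.
rewrite -/m1 -/n1 -/m2 -/n2.
rewrite /box_limit.
set c1 := cubic _ _; set c2 := cubic _ _; set c3 := cubic _ _; set c4 := cubic _ _.
clearbody c1 c2 c3 c4; move: (m1%:R : R) (n1%:R : R) (m2%:R : R) (n2%:R : R).
move: (N%:R : R) N1' => n n1' {K f mn m1 n1 m2 n2 N1 N0 N} a1 b1 a2 b2.
have nN0 : n != 0 by rewrite gt_eqF// (lt_trans _ n1').
have n2N0 : n ^+ 2 - 1 != 0 by rewrite gt_eqF// subr_gt0 exprn_egt1.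
by field; rewrite ?nN0 ?n2N0.
Qed.

End BoxSum.

(** * Limits as the mesh, then the box, shrinks *)

Section SmallMesh.
Context {R : realType}.
Variable L : R.
Hypothesis L_gt0 : 0 < L.

Lemma grid_size_ge (e : R) : 0 < e -> L / e <= (grid_size L e)%:R.
Proof. by move=> e0; have /andP[] := ceiln_bounds (divr_ge0 (ltW L_gt0) (ltW e0)). Qed.

Lemma grid_size_gt1 : \forall e \near (0 : R)^'+, (1 < grid_size L e)%N.
Proof.
near=> e; have e0 : 0 < e by near: e; exact: nbhs_right_gt.
rewrite -(ltr1n R); apply: lt_le_trans (grid_size_ge e0).
by rewrite ltr_pdivlMr// mul1r; near: e; exact: nbhs_right_lt.
Unshelve. all: by end_near. Qed.

(** Squeezed between 0 and [e / L], as [N >= L / e]. *)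
Lemma cvg_mesh : (grid_size L e)%:R^-1 @[e --> (0 : R)^'+] --> (0 : R).
Proof.
apply: (@squeeze_cvgr _ _ _ _ (fun=> 0) (fun e => e / L)).
- near=> e; have e0 : 0 < e by near: e; exact: nbhs_right_gt.
  rewrite invr_ge0 ler0n /= -[leRHS]invf_div lef_pV2 ?grid_size_ge// posrE.
    by rewrite ltr0n ltnW//; near: e; exact: grid_size_gt1.
  by rewrite divr_gt0.
- exact: cvg_cst.
- rewrite -[X in _ --> X](mul0r L^-1); apply: cvgMr_tmp.
  by apply: cvg_at_right_filter; exact: cvg_id.
Unshelve. all: by end_near. Qed.

(** Rounding costs at most 1, hence at most [1/N] after division. The abstract [g] stands for both
    [ceiln] and [truncS]. *)
Lemma cvg_rounding (g : R -> nat) (p : R) : 0 <= p ->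
    (forall z, 0 <= z -> z <= (g z)%:R <= z + 1) ->
  (g ((grid_size L e)%:R * p))%:R / (grid_size L e)%:R @[e --> (0 : R)^'+] --> p.
Proof.
move=> p0 hg.
apply: (@squeeze_cvgr _ _ _ _ (fun=> p) (fun e => p + (grid_size L e)%:R^-1)).
- near=> e; have N0 : (0 : R) < (grid_size L e)%:R.
    by rewrite ltr0n ltnW//; near: e; exact: grid_size_gt1.
  have /andP[g1 g2] := hg _ (mulr_ge0 (ltW N0) p0).
  rewrite ler_pdivlMr// mulrC g1 /= ler_pdivrMr// mulrDl mulVf ?gt_eqF//.
  by rewrite [p * _]mulrC.
- exact: cvg_cst.
- rewrite -[X in _ --> X]addr0; apply: cvgD; first exact: cvg_cst.
  exact: cvg_mesh.
Unshelve. all: by end_near. Qed.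

Lemma cvg_cubic T (F : set_system T) {FF : Filter F} (r t : T -> R) (r0 t0 : R) :
  r e @[e --> F] --> r0 -> t e @[e --> F] --> t0 ->
  cubic (r e) (t e) @[e --> F] --> cubic r0 t0.
Proof.
move=> hr ht; have hk (k : R) : (fun=> k) e @[e --> F] --> k by exact: cvg_cst.
apply: cvgB.
  apply: cvgM; last exact: hk.
  apply: cvgM; last exact: cvgB.
  apply: cvgM; last exact: ht.
  by apply: cvgB.
apply: cvgM; last exact: hk.
apply: cvgM; first by apply: cvgM => //; exact: cvgB.
by apply: cvgB => //; apply: cvgM.
Qed.

Lemma cvg_box_limit T (F : set_system T) {FF : Filter F}
    (r a1 b1 a2 b2 : T -> R) (s1 t1 s2 t2 : R) :
  r e @[e --> F] --> (0 : R) ->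
  a1 e @[e --> F] --> s1 -> b1 e @[e --> F] --> t1 ->
  a2 e @[e --> F] --> s2 -> b2 e @[e --> F] --> t2 ->
  box_limit (r e) (a1 e) (b1 e) (a2 e) (b2 e) @[e --> F] -->
  box_limit 0 s1 t1 s2 t2.
Proof.
move=> hr ha1 hb1 ha2 hb2.
have hk (k : R) : (fun=> k) e @[e --> F] --> k by exact: cvg_cst.
apply: cvgM.
  apply: cvgM => //; apply: cvgV; first by rewrite expr0n subr0 oner_neq0.
  by apply: cvgB => //; apply: cvgM.
apply: cvgD; first apply: cvgD.
- apply: cvgM; last exact: cvgB.
  by apply: cvgB; exact: cvg_cubic.
- apply: cvgM; first exact: cvgB.
  by apply: cvgB; exact: cvg_cubic.
- apply: cvgM; last exact: cvgB.
  apply: cvgM; last exact: cvgB.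
  by apply: cvgM => //; exact: cvgB.
Qed.

Definition box_density (x y delta eps : R) : R :=
  let N := grid_size L eps in
  (4 * delta ^+ 2)^-1 *
  \sum_(i < N | N%:R / L * (x - delta) <= i%:R <= N%:R / L * (x + delta))
    \sum_(j < N | N%:R / L * (y - delta) <= j%:R <= N%:R / L * (y + delta))
      manhattan_spatial L eps i j.

Lemma cvg_box_density (x y delta : R) : 0 < x -> 0 < y -> 0 < delta ->
    delta < x -> delta < L - x -> delta < y -> delta < L - y ->
  box_density x y delta eps @[eps --> 0^'+] -->
  3 / L ^+ 3 * (x + y) - 3 / L ^+ 4 * (x ^+ 2 + y ^+ 2)
    - 2 / L ^+ 4 * delta ^+ 2.
Proof.
move=> gt0x gt0y d0 dx dLx dy dLy.
have LN0 : L != 0 by rewrite gt_eqF.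
(* The box lies inside the open square, so its sides scaled by [1/L] satisfy the bounds of
   [box_sum]. *)
have bnd z : 0 < z -> delta < z -> delta < L - z ->
    [/\ 0 <= L^-1 * (z - delta), L^-1 * (z - delta) <= L^-1 * (z + delta)
      & L^-1 * (z + delta) < 1].
  move=> z0 dz dLz; split.
  - by rewrite mulr_ge0 ?invr_ge0 ?subr_ge0 // ltW.
  - rewrite ler_pM2l ?invr_gt0//; lra.
  - by rewrite mulrC ltr_pdivrMr// mul1r; lra.
have [x0 xx x1] := bnd _ gt0x dx dLx.
have [y0 yy y1] := bnd _ gt0y dy dLy.
(* At [r = 0], [cubic] is [t^2/2 - t^3/3]; the third-order part of its centred difference leaves an
   error [delta^2 / L^4] for each coordinate. *)
have -> : 3 / L ^+ 3 * (x + y) - 3 / L ^+ 4 * (x ^+ 2 + y ^+ 2)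
    - 2 / L ^+ 4 * delta ^+ 2 = (4 * delta ^+ 2)^-1 *
    box_limit 0 (L^-1 * (x - delta)) (L^-1 * (x + delta))
                (L^-1 * (y - delta)) (L^-1 * (y + delta)).
  rewrite /box_limit /cubic; field.
  by rewrite LN0 gt_eqF.
apply: (@cvg_trans _ ((4 * delta ^+ 2)^-1 * box_limit (grid_size L e)%:R^-1
    ((ceiln ((grid_size L e)%:R * (L^-1 * (x - delta))))%:R / (grid_size L e)%:R)
    ((truncS ((grid_size L e)%:R * (L^-1 * (x + delta))))%:R / (grid_size L e)%:R)
    ((ceiln ((grid_size L e)%:R * (L^-1 * (y - delta))))%:R / (grid_size L e)%:R)
    ((truncS ((grid_size L e)%:R * (L^-1 * (y + delta))))%:R / (grid_size L e)%:R)
    @[e --> 0^'+])).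
  apply: near_eq_cvg; near=> e.
  have N1 : (1 < grid_size L e)%N by near: e; exact: grid_size_gt1.
  have e0 : e != 0 by rewrite gt_eqF//; near: e; exact: nbhs_right_gt.
  rewrite /box_density -box_sum//; congr (_ * _).
  apply: eq_big => [i|i _]; first by rewrite !mulrA.
  by apply: eq_bigl => j; rewrite !mulrA.
apply: cvgM; first exact: cvg_cst.
apply: cvg_box_limit; first exact: cvg_mesh.
- by apply: cvg_rounding => //; exact: ceiln_bounds.
- by apply: cvg_rounding; [exact: le_trans xx|exact: truncS_bounds].
- by apply: cvg_rounding => //; exact: ceiln_bounds.
- by apply: cvg_rounding; [exact: le_trans yy|exact: truncS_bounds].
Unshelve. all: by end_near. Qed.

End SmallMesh.

Theorem mainTheorem7 (R : realType) (L x y : R) (hL : 0 < L)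
    (hx : 0 < x < L) (hy : 0 < y < L) :
  let box_density (delta eps : R) : R :=
    let N := grid_size L eps in
    (4 * delta ^+ 2)^-1 *
    \sum_(i < N | N%:R / L * (x - delta) <= i%:R <= N%:R / L * (x + delta))
      \sum_(j < N | N%:R / L * (y - delta) <= j%:R <= N%:R / L * (y + delta))
        manhattan_spatial L eps i j in
  (\forall delta \near 0^'+, cvg (box_density delta eps @[eps --> 0^'+])) /\
  lim (box_density delta eps @[eps --> 0^'+]) @[delta --> 0^'+] -->
    3 / L ^+ 3 * (x + y) - 3 / L ^+ 4 * (x ^+ 2 + y ^+ 2).
Proof.
move=> bd; set s := (X in _ /\ (_ --> X)).
have [x0 xL] := andP hx; have [y0 yL] := andP hy.
have bd_cvg : \forall delta \near (0 : R)^'+,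
    bd delta eps @[eps --> 0^'+] --> s - 2 / L ^+ 4 * delta ^+ 2.
  near=> delta; apply: (@cvg_box_density R L hL x y) => //.
  - by near: delta; apply: nbhs_right_lt; rewrite subr_gt0.
  - by near: delta; apply: nbhs_right_lt; rewrite subr_gt0.
split.
  by apply: filterS bd_cvg => delta h; apply/cvg_ex; exists (s - 2 / L ^+ 4 * delta ^+ 2).
(* The inner limit is replaced by its value, which is legitimate for all small [delta]. *)
apply: (@cvg_trans _ (s - 2 / L ^+ 4 * delta ^+ 2 @[delta --> 0^'+])).
  apply: near_eq_cvg; apply: filterS bd_cvg => delta h.
  by apply/esym/cvg_lim => //; exact: norm_hausdorff.
suff : s - 2 / L ^+ 4 * delta ^+ 2 @[delta --> (0 : R)^'+] -->
    (* The limit is written with [0 * 0] to match the square as a product of two limits. *)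
    s - 2 / L ^+ 4 * (0 * 0) by rewrite !mulr0 subr0.
apply: cvgB; first exact: cvg_cst.
apply: cvgM; first exact: cvg_cst.
by apply: cvgM; apply: cvg_at_right_filter; exact: cvg_id.
Unshelve. all: by end_near. Qed.
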